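(* Fix an integer $K\geq 2$. Then, for any $r=(r_1,\ldots,r_K)\in\mathcal{R}_K$, under Model B with name popularities $r_1,\ldots,r_K$, the probability that the family has a boy given that it has a girl named $n_1$ is $$ P[Eb\cup Yb\,|\,Eg_1\cup Yg_1]=p(r):=\frac{2}{3+\sum_{k=2}^K \frac{r_k}{1-r_k}}. $$ Moreover, the image $p(\mathcal{R}_K)=\{p(r): r\in\mathcal{R}_K\}$ of $\mathcal{R}_K$ under the mapping $p$ is the open interval $(0,\tfrac{2}{3})$.
   Context: For an integer $K\ge 2$, let $$\mathcal{R}_K=\Big\{r=(r_1,r_2,\ldots,r_K)\in(0,1)^K:\ \sum_{k=1}^K r_k=1,\ r_2\geq r_3\geq\cdots\geq r_K\Big\}$$ (no order constraint is imposed on $r_1$). Consider a random two-children family, with an elder child ($E$) and a younger child ($Y$). Each child is either a boy ($b$) or a girl ($g$): $Eb$, $Eg$ are the complementary events that the elder child is a boy, respectively a girl, and $Yb$, $Yg$ are the analogous complementary events for the younger child. There are $K$ available girl names $n_1,\ldots,n_K$, and each girl receives exactly one of them. For $k=1,\ldots,K$, $Eg_k$ (resp. $Yg_k$) is the event that the elder (resp. younger) child is a girl named $n_k$; thus $Eg_1,\ldots,Eg_K$ partition $Eg$ and $Yg_1,\ldots,Yg_K$ partition $Yg$. Model B with popularities $r=(r_1,\ldots,r_K)\in\mathcal{R}_K$ is a probability measure $P$ satisfying: (1) Each child is a boy with probability $1/2$ and a girl with probability $1/2$, and the genders of the two children are independent. (2) The first girl born in the family (if any) is given name $n_k$ with probability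 $r_k$: $P[Eg_k|Eg]=r_k$ and $P[Yg_k|Yg\cap Eb]=r_k$ for $k=1,\ldots,K$. (3) The name given to an elder girl and the gender of the second child are independent: $P[Yb|Eg_k]=P[Yb|Eg]=1/2$ for $k=1,\ldots,K$. (4) Two sisters may not be given the same name, and if the elder girl was named $n_k$, a possible second girl is named according to the rescaled popularities of the remaining names: $P[Yg_\ell|Eg_k\cap Yg]=r_\ell(1-\delta_{k\ell})/(1-r_k)$ for $k,\ell=1,\ldots,K$, where $\delta_{k\ell}=1$ if $k=\ell$ and $0$ otherwise. *)

(* Defs.v *)
From HB Require Import structures.
From mathcomp Require Import all_boot all_order all_algebra.
From mathcomp Require Import all_classical all_reals all_analysis.

Set Implicit Arguments.
Unset Strict Implicit.
Unset Printing Implicit Defensive.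

Import Order.TTheory GRing.Theory Num.Theory.

Local Open Scope classical_set_scope.
Local Open Scope ring_scope.

(* Names are indexed from 0: n_1, ..., n_K are the indices 0, ..., K - 1. *)

Definition popularities (R : realType) (K : nat) : set ('I_K -> R) :=
  [set r : 'I_K -> R |
    [/\ forall k, 0 < r k < 1,
        \sum_(k < K) r k = 1 &
        forall k l : 'I_K, (0 < k)%N -> (k <= l)%N -> r l <= r k]].
Arguments popularities : clear implicits.

(* The index set (0 < k)%N is the set of names n_2, ..., n_K. *)
Definition boy_probability (R : realType) (K : nat) (r : 'I_K -> R) : R :=
  2 / (3 + \sum_(k < K | (0 < k)%N) r k / (1 - r k)).

(* Elementary conditional probability; it is 0 by convention when P B = 0. *)
Definition cprob d (T : measurableType d) (R : realType)
    (P : probability T R) (A B : set T) : R :=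
  fine (P (A `&` B)) / fine (P B).

Definition indep_events d (T : measurableType d) (R : realType)
    (P : probability T R) (A B : set T) : Prop :=
  P (A `&` B) = (P A * P B)%E.

Record children d (T : measurableType d) (K : nat) := Children {
  Eb : set T;
  Yb : set T;
  Eg_ : 'I_K -> set T;
  Yg_ : 'I_K -> set T;
  measurable_Eb : measurable Eb;
  measurable_Yb : measurable Yb;
  measurable_Eg_ : forall k, measurable (Eg_ k);
  measurable_Yg_ : forall k, measurable (Yg_ k);
  trivIset_Eg_ : trivIset [set: 'I_K] Eg_;
  trivIset_Yg_ : trivIset [set: 'I_K] Yg_;
  bigcup_Eg_ : \bigcup_k Eg_ k = ~` Eb;
  bigcup_Yg_ : \bigcup_k Yg_ k = ~` Yb }.

Definition Eg d (T : measurableType d) (K : nat) (F : children T K) : set T :=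
  ~` Eb F.

Definition Yg d (T : measurableType d) (K : nat) (F : children T K) : set T :=
  ~` Yb F.

Record modelB d (T : measurableType d) (R : realType) (K : nat)
    (r : 'I_K -> R) (P : probability T R) (F : children T K) : Prop := ModelB {
  modelB_Eb : P (Eb F) = (2^-1)%:E;
  modelB_Eg : P (Eg F) = (2^-1)%:E;
  modelB_Yb : P (Yb F) = (2^-1)%:E;
  modelB_Yg : P (Yg F) = (2^-1)%:E;
  modelB_indep_bb : indep_events P (Eb F) (Yb F);
  modelB_indep_bg : indep_events P (Eb F) (Yg F);
  modelB_indep_gb : indep_events P (Eg F) (Yb F);
  modelB_indep_gg : indep_events P (Eg F) (Yg F);
  modelB_first_elder : forall k, cprob P (Eg_ F k) (Eg F) = r k;
  modelB_first_younger : forall k,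
    cprob P (Yg_ F k) (Yg F `&` Eb F) = r k;
  modelB_name_gender : forall k,
    cprob P (Yb F) (Eg_ F k) = cprob P (Yb F) (Eg F) /\
    cprob P (Yb F) (Eg F) = 2^-1;
  modelB_second : forall k l,
    cprob P (Yg_ F l) (Eg_ F k `&` Yg F) =
      r l * (1 - (k == l)%:R) / (1 - r k) }.

(* Main.v *)
(* Split the event that a girl is named n_l according to which child bears the
   name; when it is the younger one, split further according to the elder child:
   a boy, or a girl named n_k with k <> l. The pieces have probabilities r_l / 2,
   r_l / 4 and r_l r_k / (4 (1 - r_k)), while a boy together with a girl named n_l
   has probability r_l / 2.

   The range is (0, 2/3) because S(r) = sum_(k >= 2) r_k / (1 - r_k) takes exactly
   the positive values: along a suitable polynomial curve in R_K, S tends to 0 at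
   one end and to infinity at the other, and is continuous in between. *)
Require Import Defs.
From HB Require Import structures.
From mathcomp Require Import all_boot all_order all_algebra.
From mathcomp Require Import all_classical all_reals all_analysis.
From mathcomp Require Import ring lra.

Import Order.TTheory GRing.Theory Num.Theory.

Local Open Scope classical_set_scope.
Local Open Scope ring_scope.

Section FineProbability.
Context {d : measure_display} {T : measurableType d} {R : realType}.
Variable P : probability T R.
Implicit Types A B : set T.

Lemma fine_probabilityU A B : measurable A -> measurable B ->
  A `&` B = set0 -> fine (P (A `|` B)) = fine (P A) + fine (P B).
Proof. by move=> mA mB AB0; rewrite measureU// fineD// fin_num_measure. Qed.

Lemma fine_probabilityIC A B : measurable A -> measurable B ->
  fine (P A) = fine (P (A `&` B)) + fine (P (A `&` ~` B)).
Proof.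
move=> mA mB; rewrite -fine_probabilityU.
- by rewrite -setIUr setUv setIT.
- exact: measurableI.
- by apply: measurableI => //; exact: measurableC.
- by rewrite setIACA setICr setI0.
Qed.

Lemma fine_probability_bigcup (I : finType) (A : set T) (F : I -> set T) :
  measurable A -> (forall i, measurable (F i)) -> trivIset [set: I] F ->
  fine (P (A `&` \bigcup_i F i)) = \sum_i fine (P (A `&` F i)).
Proof.
move=> mA mF tF; have mAF i : measurable (A `&` F i) by exact: measurableI.
rewrite setI_bigcupr measure_fin_bigcup//;
  [|exact: finite_finset|exact: trivIset_setIl].
have -> : [set: I] = [set` index_enum I].
  by apply/seteqP; split => i //= _; rewrite mem_index_enum.
rewrite -fsbig_seq ?index_enum_uniq// sum_fine// => i _.
exact: fin_num_measure.
Qed.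

(** Turns the conditional data of Model B into joint probabilities. *)
Lemma cprob_mul A B : fine (P B) != 0 ->
  fine (P (A `&` B)) = cprob P A B * fine (P B).
Proof. by move=> B0; rewrite /cprob divfK. Qed.

End FineProbability.

Arguments fine_probabilityIC {d T R} P {A B}.

Section ModelB.
Context {d : measure_display} {T : measurableType d} {R : realType} {K : nat}.
Variables (r : 'I_K -> R) (P : probability T R) (F : children T K).
Hypotheses (r01 : forall k, 0 < r k < 1) (mB : modelB r P F).

Let r_neq0 k : r k != 0.
Proof. by have /andP[/gt_eqF->] := r01 k. Qed.

Let mEb : measurable (Eb F). Proof. exact: measurable_Eb. Qed.
Let mYb : measurable (Yb F). Proof. exact: measurable_Yb. Qed.
Let mEg k : measurable (Eg_ F k). Proof. exact: measurable_Eg_. Qed.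
Let mYg k : measurable (Yg_ F k). Proof. exact: measurable_Yg_. Qed.

Lemma Eg_sub k : Eg_ F k `<=` Eg F.
Proof. by rewrite /Eg -bigcup_Eg_; exact: bigcup_sup. Qed.

Lemma Yg_sub k : Yg_ F k `<=` Yg F.
Proof. by rewrite /Yg -bigcup_Yg_; exact: bigcup_sup. Qed.

Lemma modelB_Eg_ k : fine (P (Eg_ F k)) = r k / 2.
Proof.
have Eg2 : fine (P (Eg F)) = 2^-1 by rewrite (modelB_Eg mB).
rewrite -[Eg_ F k](setIidl (@Eg_sub k)) cprob_mul ?Eg2 ?invr_eq0//.
by rewrite (modelB_first_elder mB).
Qed.

Lemma modelB_Yb_Eg_ k : fine (P (Yb F `&` Eg_ F k)) = r k / 4.
Proof.
rewrite cprob_mul modelB_Eg_ ?mulf_neq0 ?invr_eq0//.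
by have [-> ->] := modelB_name_gender mB k; field.
Qed.

(** This is the event on which [modelB_second] conditions; its probability is nonzero, so that law
    yields joint probabilities. *)
Lemma modelB_Eg_Yg k : fine (P (Eg_ F k `&` Yg F)) = r k / 4.
Proof.
have := fine_probabilityIC P (mEg k) mYb.
by rewrite modelB_Eg_ (setIC _ (Yb F)) modelB_Yb_Eg_ -/(Yg F) => ?; lra.
Qed.

Lemma modelB_Yg_Eg_ k l :
  fine (P (Yg_ F l `&` Eg_ F k)) = r l * (1 - (k == l)%:R) / (1 - r k) * (r k / 4).
Proof.
have <- := modelB_Eg_Yg k; rewrite -(modelB_second mB) -cprob_mul.
  by rewrite setICA (setIidl (@Yg_sub l)) setIC.
by rewrite modelB_Eg_Yg mulf_neq0 ?invr_eq0.
Qed.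

Lemma modelB_Yg_Eb l : fine (P (Yg_ F l `&` Eb F)) = r l / 4.
Proof.
have YgEb : fine (P (Yg F `&` Eb F)) = 4^-1.
  rewrite setIC (modelB_indep_bg mB) (modelB_Eb mB) (modelB_Yg mB) /=.
  by field.
rewrite -[Yg_ F l in LHS](setIidl (@Yg_sub l)) -setIA cprob_mul YgEb ?invr_eq0//.
by rewrite (modelB_first_younger mB).
Qed.

Lemma modelB_boy_and_girl l :
  fine (P ((Eb F `|` Yb F) `&` (Eg_ F l `|` Yg_ F l))) = r l / 2.
Proof.
(* Two of the four pairings would make one child both a boy and a girl. *)
have -> : (Eb F `|` Yb F) `&` (Eg_ F l `|` Yg_ F l) =
    (Yg_ F l `&` Eb F) `|` (Yb F `&` Eg_ F l).
  have Eb0 : Eb F `&` Eg_ F l = set0.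
    by apply/disjoints_subset => x /[swap] /Eg_sub.
  have Yb0 : Yb F `&` Yg_ F l = set0.
    by apply/disjoints_subset => x /[swap] /Yg_sub.
  by rewrite setIUl !setIUr Eb0 Yb0 set0U setU0 (setIC (Eb F)).
rewrite fine_probabilityU; first by rewrite modelB_Yg_Eb modelB_Yb_Eg_; field.
- exact: measurableI.
- exact: measurableI.
- by apply/disjoints_subset => x [_ Ebx] [_ /Eg_sub].
Qed.

(** In units of [r l / 4], the 3 is 2 for the elder girl plus 1 for the younger girl after a boy;
    the sum comes from elder sisters with other names. *)
Lemma modelB_girl l : fine (P (Eg_ F l `|` Yg_ F l)) =
  r l / 4 * (3 + \sum_(k < K | k != l) r k / (1 - r k)).
Proof.
(* Sisters have distinct names only almost surely: the two events may meet in a null set. *)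
have EY0 : fine (P (Yg_ F l `&` Eg_ F l)) = 0.
  by rewrite modelB_Yg_Eg_ eqxx subrr mulr0 !mul0r.
have YE : fine (P (Yg_ F l `&` ~` Eb F)) =
    r l / 4 * \sum_(k < K | k != l) r k / (1 - r k).
  rewrite -bigcup_Eg_ fine_probability_bigcup//; last exact: trivIset_Eg_.
  rewrite (bigD1 l)//= EY0 add0r mulr_sumr; apply: eq_bigr => k kl.
  by rewrite modelB_Yg_Eg_ (negbTE kl) subr0 mulr1; ring.
have YEl := fine_probabilityIC P (mYg l) (mEg l).
have YEb := fine_probabilityIC P (mYg l) mEb.
rewrite modelB_Yg_Eb YE in YEb.
have -> : Eg_ F l `|` Yg_ F l = Eg_ F l `|` (Yg_ F l `&` ~` Eg_ F l).
  by rewrite setUIr setUv setIT.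
rewrite fine_probabilityU//; first by rewrite modelB_Eg_; lra.
- by apply: measurableI => //; exact: measurableC.
- by rewrite setICA setICr setI0.
Qed.

Lemma modelB_boy_given_girl l : cprob P (Eb F `|` Yb F) (Eg_ F l `|` Yg_ F l) =
  2 / (3 + \sum_(k < K | k != l) r k / (1 - r k)).
Proof.
have S_ge0 : 0 <= \sum_(k < K | k != l) r k / (1 - r k).
  apply: sumr_ge0 => k _; have /andP[rk0 rk1] := r01 k.
  by rewrite divr_ge0// ?subr_ge0 ltW.
rewrite /cprob modelB_boy_and_girl modelB_girl; field.
by rewrite r_neq0 gt_eqF// ltr_wpDr.
Qed.

End ModelB.

Section Range.
Variable R : realType.

Lemma boy_probability_lt K (r : 'I_K -> R) : (2 <= K)%N ->
  (forall k, 0 < r k < 1) -> 0 < boy_probability r < 2 / 3.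
Proof.
case: K r => [|[|n]]// r _ r01.
have odds_gt0 k : 0 < r k / (1 - r k).
  by have /andP[? ?] := r01 k; rewrite divr_gt0// subr_gt0.
have S_gt0 : 0 < \sum_(k < n.+2 | (0 < k)%N) r k / (1 - r k).
  (* The index of [n_2], present since [K >= 2], supplies a positive term and hence strictness. *)
  rewrite (bigD1 (lift ord0 ord0))//= ltr_wpDr//.
  by apply: sumr_ge0 => k _; exact: ltW.
have ? : 0 < 3 + \sum_(k < n.+2 | (0 < k)%N) r k / (1 - r k) by rewrite addr_gt0.
by rewrite /boy_probability divr_gt0//= ltr_pM2l// ltf_pV2 ?posrE// ltrDl.
Qed.

(* The factor [x (1 - x)] keeps [n_3, ..., n_K] less popular than [n_2] and
   leaves room for [n_1] even as [x] tends to [1]. *)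
Definition skewed_popularity n (x : R) (k : 'I_n.+2) : R :=
  let y := x * (1 - x) / n.+2%:R in
  if k == 0%N :> nat then 1 - x - n%:R * y else if k == 1%N :> nat then x else y.

Lemma skewed_popularityP n x : 0 < x < 1 ->
  popularities R n.+2 (skewed_popularity n x).
Proof.
move=> /andP[x0 x1]; rewrite /skewed_popularity.
set y := x * (1 - x) / n.+2%:R.
have y0 : 0 < y by rewrite /y divr_gt0// mulr_gt0// subr_gt0.
(* Both [y] and [n * y] are below [(n + 2) * y = x * (1 - x)], which is below both [x] and
   [1 - x]. *)
have yN : y * (n%:R + 2) = x * (1 - x).
  by rewrite /y -natrD addn2 divfK ?pnatr_eq0.
have n0 : 0 <= n%:R :> R by [].
have ny0 : 0 <= n%:R * y by rewrite mulr_ge0// ltW.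
have yx : y < x by nra.
have nyx : n%:R * y < 1 - x by nra.
split.
- by move=> k; case: ifP => _; [|case: ifP => _]; apply/andP; split; lra.
- rewrite big_ord_recl big_ord_recl/= sumr_const card_ord -mulr_natl; ring.
- move=> k l k0 kl /=; rewrite (gtn_eqF k0) (gtn_eqF (leq_trans k0 kl)).
  case: ifPn => [/eqP l1|_]; last by case: ifP => // _; exact: ltW.
  by have -> : k == 1%N :> nat by rewrite eqn_leq k0 andbT -l1.
Qed.

Lemma boy_probability_skewed n (x : R) (y := x * (1 - x) / n.+2%:R) :
  boy_probability (skewed_popularity n x) =
  2 / (3 + (x / (1 - x) + n%:R * (y / (1 - y)))).
Proof.
rewrite /boy_probability /skewed_popularity big_mkcond big_ord_recl/= add0r.
by rewrite big_ord_recl/= sumr_const card_ord [n%:R * _]mulr_natl.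
Qed.

Lemma skewed_odds_onto n (s : R) : 0 < s ->
  exists2 x, 0 < x < 1 & let y := x * (1 - x) / n.+2%:R in
    x / (1 - x) + n%:R * (y / (1 - y)) = s.
Proof.
(* At [a] the odds of [n_2] alone equal [s]. Searching on [[0, a]] with [a < 1] avoids the pole at
   1. *)
move=> s0; set c : R := n.+2%:R^-1; set a := s / (1 + s).
have c0 : 0 < c by rewrite invr_gt0.
have c1 : c <= 1 by rewrite invf_le1// ler1n.
have n0 : 0 <= n%:R :> R by [].
have a0 : 0 < a by rewrite divr_gt0// addr_gt0.
have aE : a = s * (1 - a) by rewrite /a; field; lra.
have a1 : a < 1 by nra.
clearbody a.
(* [p] is the equation in [x] cleared of its denominators; as [a / (1 - a) = s],
   it is nonnegative at [a]. *)
pose Y : {poly R} := c%:P * ('X * (1 - 'X)).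
pose p := 'X * (1 - Y) + n%:R%:P * Y * (1 - 'X) - s%:P * ((1 - 'X) * (1 - Y)).
have pE x : p.[x] = x * (1 - c * (x * (1 - x))) + n%:R * (c * (x * (1 - x))) * (1 - x)
    - s * ((1 - x) * (1 - c * (x * (1 - x)))).
  by rewrite /p /Y !hornerE.
have [||x /andP[x0 xa] /rootP] := @poly_ivt R p 0 a; first exact: ltW.
  rewrite !pE; apply/andP; split; first by lra.
  by rewrite (mulrA s) -aE addrAC subrr add0r;
    do !apply: mulr_ge0 => //; rewrite ?subr_ge0 ltW.
rewrite pE => px0; have x_gt0 : 0 < x.
  (* The root is not 0, because [p] takes the value [- s] there. *)
  by rewrite lt_neqAle x0 andbT; apply/eqP => xE; move: px0; rewrite -xE; lra.
have x1 : x < 1 by exact: le_lt_trans a1.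
exists x; first by rewrite x_gt0.
rewrite /= (mulrC _ n.+2%:R^-1) -/c.
have ? : 1 - c * (x * (1 - x)) != 0 by rewrite gt_eqF//; nra.
have ? : 1 - x != 0 by rewrite gt_eqF// subr_gt0.
apply/eqP; rewrite -subr_eq0; apply/eqP.
(* The difference of the two sides is [p.[x]] over the cleared denominators. *)
transitivity (0 / ((1 - x) * (1 - c * (x * (1 - x))))); last by rewrite mul0r.
by rewrite -px0; field; apply/andP.
Qed.

Lemma boy_probability_onto n t : 0 < t < 2 / 3 ->
  exists2 r, popularities R n.+2 r & boy_probability r = t.
Proof.
move=> /andP[t0 t23].
(* Solving [2 / (3 + s) = t] gives this [s], positive because [t < 2 / 3]. *)
have [|x x01 xE] := @skewed_odds_onto n (2 / t - 3).
  by rewrite subr_gt0 ltr_pdivlMr//; lra.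
exists (skewed_popularity n x); first exact: skewed_popularityP.
rewrite boy_probability_skewed xE; field.
by apply/andP; split; rewrite gt_eqF//; lra.
Qed.

End Range.

Theorem theorem2 (R : realType) (K : nat) (hK : (2 <= K)%N) :
  (forall (r : 'I_K -> R), popularities R K r ->
    forall (d : measure_display) (T : measurableType d)
      (P : probability T R) (F : children T K),
    modelB r P F ->
    let n1 : 'I_K := Ordinal (ltnW hK) in
    cprob P (Eb F `|` Yb F) (Eg_ F n1 `|` Yg_ F n1) = boy_probability r) /\
  [set boy_probability r | r in popularities R K] = [set` `]0, (2 / 3)[%R].
Proof.
split.
  move=> r [r01 _ _] d T P F mB n1; rewrite (modelB_boy_given_girl _ _ _ r01 mB).
  (* [n1] has index 0, so the names other than [n1] are those of positive index. *)
  by under eq_bigl do rewrite -val_eqE/= -lt0n.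
apply/seteqP; split => [_ [r [r01 _ _] <-]|t].
  by rewrite /= in_itv/=; exact: boy_probability_lt.
rewrite /= in_itv/=; case: K hK => [|[|n]]// _ t023.
by have [r rP <-] := boy_probability_onto _ n _ t023; exists r.
Qed.
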